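(* For all integers $k\ge 0$ and $n\ge 0$, $$d_{25k+1}(25n+23)\equiv 0\pmod 5\qquad\text{and}\qquad d_{75k+16}(25n+8)\equiv 0\pmod 5.$$
   Context: Notation: $(a;q)_{\infty}:=\prod_{j=0}^{\infty}(1-aq^j)$. For an integer $k\ge 0$ the integers $d_k(n)$, $n\ge 0$, are defined by $$\sum_{n=0}^{\infty}d_k(n)q^n=\frac{(q^2;q^2)_{\infty}^{k}}{(q;q)_{\infty}^{3k+1}},\qquad |q|<1.$$ *)

(* Defs.v *)
From HB Require Import structures.
From mathcomp Require Import all_boot all_order all_algebra.
From mathcomp Require Import all_classical all_reals all_analysis.
From mathcomp Require Import complex.

Set Implicit Arguments.
Unset Strict Implicit.
Unset Printing Implicit Defensive.

Import Order.TTheory GRing.Theory Num.Theory.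
Import numFieldNormedType.Exports.

Local Open Scope classical_set_scope.
Local Open Scope ring_scope.
Local Open Scope complex_scope.

(* (a; q)_oo for complex a and q. [R[i]^o] is R[i] with the topology of its
   norm. [lim] is a total operator; the partial products do converge for every
   a as soon as `|q| < 1. *)
Definition qpochhammer (R : realType) (a q : R[i]) : R[i] :=
  lim ((fun N : nat => \prod_(j < N) (1 - a * q ^+ j) : R[i]^o) @ \oo).

(* [d k n] is the coefficient of q ^+ n in the power series expansion of
   (q^2; q^2)_oo ^ k / (q; q)_oo ^ (3k + 1) on the unit disc. As power series
   coefficients are unique, this determines [d]; the quotient makes sense since
   (q; q)_oo has no zero on the disc. *)
Definition is_d (R : realType) (d : nat -> nat -> int) : Prop :=
  forall (k : nat) (q : R[i]), `|q| < 1 ->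
    series (fun n : nat => (d k n)%:~R * q ^+ n : R[i]^o) @ \oo -->
      (qpochhammer (q ^+ 2) (q ^+ 2) ^+ k / qpochhammer q q ^+ (3 * k + 1)
        : R[i]^o).

(* Main.v *)
Require Import Defs.
From mathcomp Require Import all_boot all_order all_algebra.
From mathcomp Require Import all_classical all_reals all_analysis.
From mathcomp Require Import finfield complex ring lra zify.

(** Write f_m for the product of the factors 1 - q^(m j), j >= 1. The series of
    the d_k is f_2^k / f_1^(3k+1), and only its residue modulo 5 matters.

    Modulo 5, the fifth power of a series p(q) is p(q^5). For the index 25k+1,
    multiplying numerator and denominator by f_1 turns the series into a series
    in q^25 times f_1 f_2 / f_5; for the index 75k+16 it becomes a series in
    q^25 times f_10^3 f_1 f_2. By the pentagonal number theorem an exponent i of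
    f_1 satisfies 24 i + 1 = x^2, so i is 0, 1 or 2 modulo 5, and i = 1 modulo 5
    forces i = 1 modulo 25. Hence a term of f_1 f_2 whose exponent is 3 modulo 5
    has an exponent that is 3 modulo 25: the exponents 5n+3 of f_1 f_2 contribute
    q^3 G(q^25) for some series G ([sect3_euler]).

    It remains to look, after the substitution q^5 -> q, at the exponents 5n+4
    of 1 / f_1, which is f_1^4 modulo 5 up to a series in q^5, and at the
    exponents 5n+1 of f_2^3. Both vanish modulo 5 because of Jacobi's formula
    for f_1^3, whose coefficient at m(m+1)/2 is +-(2m+1): modulo 5, f_1^3 has
    only exponents that are 0 or 1 modulo 5 ([euler_cube_support5]). Adding an
    exponent of f_1 to one of f_1^3 never gives 4 modulo 5, and doubling an
    exponent of f_1^3 never gives 1.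

    All of this is carried out on polynomials, with the truncated products
    [euler_poly] and congruences modulo X^n. The pentagonal number theorem comes
    from Shanks' finite identity [shanks], and Jacobi's formula from the
    derivative at 1 of a finite triple product ([jacobi_finite]).

    The passage from the analytic definition of d_k to polynomials is
    [is_d_poly]. For small real t > 0, f_1(t) differs from its n-th partial
    product by O(t^n), and the sum of the series of d_k differs from its n-th
    partial sum by O(t^n). The identity between sums of series thus becomes an
    identity between two polynomials in t up to O(t^n), and two polynomials that
    close to each other near 0 have the same coefficients below n. *)

Set Implicit Arguments.
Unset Strict Implicit.
Unset Printing Implicit Defensive.

Import Order.TTheory GRing.Theory Num.Theory.
Import numFieldNormedType.Exports.
Local Open Scope ring_scope.

(** * Polynomials modulo a power of the variable *)

(** Congruence of polynomials modulo X^n: equal coefficients below n. *)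
Definition eqX (A : comNzRingType) (n : nat) (p q : {poly A}) : Prop :=
  forall i, (i < n)%N -> p`_i = q`_i.

Section Trunc.
Variable A : comNzRingType.
Implicit Types p q : {poly A}.

Lemma eqX_refl n p : eqX n p p. Proof. by []. Qed.

Lemma eqX_sym n p q : eqX n p q -> eqX n q p.
Proof. by move=> h i ltin; rewrite h. Qed.

Lemma eqX_trans n q p (r : {poly A}) : eqX n p q -> eqX n q r -> eqX n p r.
Proof. by move=> h1 h2 i ltin; rewrite h1 // h2. Qed.

Lemma eqXM n p q p' q' : eqX n p p' -> eqX n q q' -> eqX n (p * q) (p' * q').
Proof.
move=> hp hq i ltin; rewrite !coefM; apply: eq_bigr => j _.
by rewrite hp ?hq //; have := ltn_ord j; lia.
Qed.

Lemma eqX_sum n (I : Type) (s : seq I) (P : pred I) (F G : I -> {poly A}) :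
  (forall i, P i -> eqX n (F i) (G i)) ->
  eqX n (\sum_(i <- s | P i) F i) (\sum_(i <- s | P i) G i).
Proof.
by move=> h i ltin; rewrite !coef_sum; apply: eq_bigr => j Pj; apply: h.
Qed.

Lemma eqXD n p q p' q' : eqX n p p' -> eqX n q q' -> eqX n (p + q) (p' + q').
Proof. by move=> hp hq i ltin; rewrite !coefD hp ?hq. Qed.

Lemma eqX_sum0 n (I : Type) (s : seq I) (P : pred I) (F : I -> {poly A}) :
  (forall i, P i -> eqX n (F i) 0) -> eqX n (\sum_(i <- s | P i) F i) 0.
Proof.
move=> h; rewrite -[X in eqX n _ X](@big1_eq _ 0 +%R _ s P).
exact: eqX_sum.
Qed.

Lemma eqX_Xn0 n m p : (n <= m)%N -> eqX n (p * 'X^m) 0.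
Proof. by move=> lenm i ltin; rewrite coefMXn coef0 (leq_trans ltin). Qed.

Lemma eqX_cancel n p q : p`_0 = 1 -> eqX n (p * q) 0 -> eqX n q 0.
Proof.
move=> p0 h; elim/ltn_ind => i ih ltin.
have := h i ltin; rewrite coefM big_ord_recl p0 mul1r subn0 coef0 big1 ?addr0 //.
move=> j _; rewrite ih ?coef0 ?mulr0 // lift0; have := ltn_ord j; lia.
Qed.

End Trunc.

(** * Extraction of the coefficients in an arithmetic progression *)

Section Sect.
Variable A : comNzRingType.
Implicit Types p q : {poly A}.

(** The polynomial whose i-th coefficient is the coefficient of p at m i + r. *)
Definition sect (m r : nat) p : {poly A} := \poly_(i < size p) p`_(m * i + r).

Lemma coef_sect m r p i : (0 < m)%N -> (sect m r p)`_i = p`_(m * i + r).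
Proof.
move=> m0; rewrite coef_poly; case: ltnP => // lesi.
rewrite nth_default // (leq_trans lesi) //.
by rewrite (leq_trans (leq_pmull i m0)) ?leq_addr.
Qed.

Lemma sect_eqX m n N r p q : (0 < m)%N -> (r < m)%N -> (m * n <= N)%N ->
  eqX N p q -> eqX n (sect m r p) (sect m r q).
Proof.
move=> m0 ltrm hN h i ltin; rewrite !coef_sect // h //.
by have : (m * i.+1 <= m * n)%N; [rewrite leq_mul2l ltin orbT | rewrite mulnS; lia].
Qed.

(** Sectioning is linear over the polynomials in X^m. *)
Lemma sect_compM m r p q : (0 < m)%N -> (r < m)%N ->
  sect m r ((p \Po 'X^m) * q) = p * sect m r q.
Proof.
move=> m0 ltrm; apply/polyP => i; rewrite coef_sect // !coefM.
(* The nonzero terms of the convolution on the left have an index divisible by m. *)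
pose F j := if (m %| j)%N then p`_(j %/ m) * q`_(m * i + r - j) else 0.
transitivity (\sum_(j < m * i.+1) F j).
  rewrite (@eq_bigr _ _ _ _ _ _ _ (fun j => F (nat_of_ord j))); last first.
    move=> j _; rewrite /F coef_comp_poly_Xn //.
    by case: ifP => //; rewrite mul0r.
  rewrite [RHS](big_ord_widen_cond _ xpredT F (leqnn _)) /=.
  rewrite (big_ord_widen_cond (m * i.+1) xpredT F) /=; last by nia.
  rewrite [RHS]big_mkcond /= big_mkcond /=; apply: eq_bigr => j _.
  rewrite ltn_ord; case: ifP => // /negbT; rewrite -leqNgt => hj.
  rewrite /F; case: ifP => // /dvdnP [c ec].
  have lj := ltn_ord j; rewrite ec mulnC ltn_pmul2l // ltnS in lj.
  by move: hj; rewrite ec mulnC; have := leq_mul (leqnn m) lj; lia.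
have mulsum (G : nat -> A) k : (forall j, ~~ (m %| j)%N -> G j = 0) ->
    \sum_(j < m * k) G j = \sum_(j < k) G (m * j)%N.
  move=> hG; elim: k => [|k ih]; first by rewrite muln0 !big_ord0.
  rewrite big_ord_recr /= -ih mulnS addnC big_split_ord /=; congr (_ + _).
  case: m m0 hG {ih ltrm F} => // m' _ hG.
  rewrite big_ord_recl /= addn0 big1 ?addr0 // => j _; apply: hG.
  rewrite /bump /= dvdn_addr ?dvdn_mulr //.
  by apply/negP => /dvdn_leq; have := ltn_ord j; lia.
rewrite mulsum => [|j /negPf h]; last by rewrite /F h.
apply: eq_bigr => j _; rewrite /F dvdn_mulr // mulKn // coef_sect //.
by congr (_ * _`_ _); have := ltn_ord j; nia.
Qed.

End Sect.

(** * Partial products of Euler's product *)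

(** The product of the 1 - X^j for 1 <= j <= n; the factors are indexed from 0. *)
Definition euler_poly (A : comNzRingType) (n : nat) : {poly A} :=
  \prod_(i < n) (1 - 'X^(i.+1)).

Lemma euler_polyS (A : comNzRingType) n :
  euler_poly A n.+1 = euler_poly A n * (1 - 'X^(n.+1)).
Proof. by rewrite /euler_poly big_ord_recr. Qed.

Lemma map_euler_poly (A B : comNzRingType) (f : {rmorphism A -> B}) n :
  map_poly f (euler_poly A n) = euler_poly B n.
Proof.
rewrite /euler_poly rmorph_prod; apply: eq_bigr => i _.
by rewrite rmorphB rmorph1 /= map_polyXn.
Qed.

Lemma coef0_euler_poly (A : comNzRingType) n : (euler_poly A n)`_0 = 1.
Proof.
elim: n => [|n ih]; first by rewrite /euler_poly big_ord0 coef1.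
by rewrite euler_polyS mulrBr mulr1 coefB coefMXn ih subr0.
Qed.

Lemma euler_poly_trunc (A : comNzRingType) m n : (m <= n)%N ->
  eqX m.+1 (euler_poly A n) (euler_poly A m).
Proof.
move=> /subnK <-; elim: (n - m)%N => [|k ih] //.
rewrite addSn euler_polyS mulrBr mulr1; apply: eqX_trans ih => i ltim.
by rewrite coefB coefMXn ifT ?subr0 //; lia.
Qed.

Lemma coef0_euler_polyX (A : comNzRingType) n m : (euler_poly A n ^+ m)`_0 = 1.
Proof. by rewrite -horner_coef0 horner_exp horner_coef0 coef0_euler_poly expr1n. Qed.

(** * The pentagonal number theorem *)

Section Pentagonal.
Variable A : comNzRingType.

(** The quotient of the n-th partial product by the s-th one, for s <= n. *)
Definition euler_ratio n s : {poly A} := \prod_(s <= i < n) (1 - 'X^(i.+1)).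

(** The general term of Shanks' sum. The term of index 0 is the n-th partial
    product; the others vanish modulo X^(n+1). *)
Definition shanks_term n s : {poly A} :=
  (-1) ^+ s * euler_ratio n s * 'X^(s * n + 'C(s.+1, 2)).

(** Shanks' finite form of the pentagonal number theorem. *)
Lemma shanks n :
  \sum_(s < n.+1) shanks_term n s =
  1 + \sum_(1 <= s < n.+1) (-1) ^+ s * ('X^(s * (3 * s).-1 %/ 2) + 'X^(s * (3 * s).+1 %/ 2)).
Proof.
have C2 s : ('C(s.+1, 2) * 2 = s * s.+1)%N.
  by rewrite bin2 -[s.+1.-1]/s mulnC mul2n halfK oddM /=; case: (odd s); lia.
elim: n => [|n ih].
  by rewrite big_ord1 big_geq // addr0 /shanks_term /euler_ratio big_geq // !mul1r.
rewrite big_nat_recr //= addrA -ih big_ord_recr /=.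
(* The difference of two consecutive sums telescopes. *)
have H : forall k, (k <= n.+1)%N -> \sum_(s < k) (shanks_term n.+1 s - shanks_term n s) =
   if k is s.+1 then - ((-1) ^+ s * euler_ratio n s * 'X^(s.+1 * n + 'C(s.+2, 2))) else 0.
  elim=> [|k ihk] lek; first by rewrite big_ord0.
  rewrite big_ord_recr /= {}ihk 1?ltnW // /shanks_term.
  have QS s : (s <= n)%N -> euler_ratio n.+1 s = euler_ratio n s * (1 - 'X^(n.+1)).
    by move=> ?; rewrite /euler_ratio big_nat_recr.
  rewrite QS //.
  have e : ('C(k.+2, 2) = 'C(k.+1, 2) + k.+1)%N by rewrite binS bin1 addnC.
  case: k lek e => [|k] lek e.
    rewrite e (_ : 'C(1, 2) = 0%N) // !mul0n !mul1n !expr0 add0r add0n exprD !exprS !expr0; ring.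
  have QS' : euler_ratio n k = (1 - 'X^(k.+1)) * euler_ratio n k.+1.
    by rewrite /euler_ratio big_ltn.
  rewrite QS' e.
  rewrite !mulSn !mulnS !exprD !exprS; ring.
have := H n.+1 (leqnn _); rewrite sumrB /= => /(canRL (subrK _)) ->.
have QE m : euler_ratio m m = 1 by rewrite /euler_ratio big_geq.
rewrite /shanks_term !QE !mulr1.
have -> : (n.+1 * (3 * n.+1).-1 %/ 2 = n.+1 * n + 'C(n.+2, 2))%N.
  by have := C2 n.+1; nia.
have -> : (n.+1 * (3 * n.+1).+1 %/ 2 = n.+1 * n.+1 + 'C(n.+2, 2))%N.
  by have := C2 n.+1; nia.
rewrite !exprS; ring.
Qed.

End Pentagonal.

Lemma shanks_euler (A : comNzRingType) n :
  eqX n.+1 (euler_poly A n)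
    (1 + \sum_(1 <= s < n.+1)
       (-1) ^+ s * ('X^(s * (3 * s).-1 %/ 2) + 'X^(s * (3 * s).+1 %/ 2))).
Proof.
rewrite -shanks big_ord_recl /= {1}/shanks_term {1}/euler_ratio.
rewrite mul1r mul0n add0n mulr1 big_mkord -/(euler_poly A n).
rewrite -[X in eqX _ X _]addr0; apply: eqXD => //; apply/eqX_sym/eqX_sum0.
by move=> s _; apply: eqX_Xn0; rewrite /bump /= !add1n binS bin1 mulSn; lia.
Qed.

(** The exponents are the pentagonal numbers s(3s-1)/2 and s(3s+1)/2, for which
    24 i + 1 is the square of 6s - 1 and of 6s + 1. *)
Lemma euler_poly_support (A : comNzRingType) n i : (i <= n)%N ->
  (forall x, 24 * i + 1 <> x ^ 2)%N -> (euler_poly A n)`_i = 0.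
Proof.
move=> lein nosq; rewrite shanks_euler // coefD coef1 coef_sum.
have /negPf -> : i != 0%N by apply/eqP => i0; apply: (nosq 1%N); rewrite i0.
rewrite add0r big1_seq // => s /=; rewrite mem_index_iota => /andP[s1 _].
have half_par (e : nat) : (odd e = false -> e %/ 2 * 2 = e)%N by lia.
have coefE0 e : (24 * e + 1 == (6 * s + 1) ^ 2)%N || (24 * e + 1 == (6 * s - 1) ^ 2)%N ->
    ('X^e : {poly A})`_i = 0.
  move=> sq; rewrite coefXn; have [ie|//] := eqVneq i e.
  by case/orP: sq => /eqP; rewrite -ie => /nosq.
have par1 : ((s * (3 * s).-1 %/ 2) * 2 = s * (3 * s).-1)%N.
  apply: half_par; rewrite oddM; case: s s1 {coefE0} => // m _.
  have -> : (3 * m.+1).-1 = (3 * m + 2)%N by clear; lia.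
  by rewrite oddD oddM /=; case: (odd m).
have par2 : ((s * (3 * s).+1 %/ 2) * 2 = s * (3 * s).+1)%N.
  by apply: half_par; rewrite oddM /= oddM /=; case: (odd s).
rewrite -signr_odd mulr_sign; case: (odd s); rewrite ?coefN coefD !coefE0 ?addr0 ?oppr0 //.
all: apply/orP; [> left | right | left | right]; apply/eqP; rewrite -mulnn.
all: move: par1 par2; move: (s * (3 * s).-1 %/ 2)%N (s * (3 * s).+1 %/ 2)%N.
all: case: s s1 {coefE0} => [|m] // _ e1 e2.
all: have -> : (3 * m.+1).-1 = (3 * m + 2)%N by clear; lia.
all: have e6 : (6 * m.+1 - 1 = 6 * m + 5)%N by clear; lia.
all: rewrite ?e6 {e6}.
all: by move=> h1 h2; clear -h1 h2; lia.
Qed.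

(** If i = 1 modulo 5 then 5 divides the square 24 i + 1, so 25 does. *)
Lemma euler_poly_support5 (A : comNzRingType) n i : (i <= n)%N ->
  ~~ ((i %% 5 <= 2) && ((i %% 5 == 1) ==> (i %% 25 == 1)))%N -> (euler_poly A n)`_i = 0.
Proof.
move=> lein nh; apply: euler_poly_support => // x ex; move: nh; rewrite negb_and.
rewrite -mulnn in ex.
have h5 : ((24 * i + 1) %% 5 = ((x %% 5) * (x %% 5)) %% 5)%N by rewrite ex modnMm.
have h25 : (x %% 5 = 0 -> (24 * i + 1) %% 25 = 0)%N.
  move=> x0; rewrite ex; have -> : x = (5 * (x %/ 5))%N by lia.
  by rewrite mulnACA modnMr.
have : (x %% 5 < 5)%N by rewrite ltn_mod.
move: h5 h25; case: (x %% 5)%N => [|[|[|[|[|]]]]] //= h5 h25 _; lia.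
Qed.

(** * Gaussian binomial coefficients *)

Section GaussianBinomial.
Variable A : comNzRingType.

(** The Gaussian binomial coefficient in the variable X, by Pascal's rule. *)
Fixpoint gbin (n k : nat) : {poly A} :=
  match n, k with
  | _, 0 => 1
  | 0, _.+1 => 0
  | n'.+1, k'.+1 => gbin n' k' + 'X^(k'.+1) * gbin n' k
  end.

Lemma gbin0 n : gbin n 0 = 1. Proof. by case: n. Qed.

Lemma gbinS n k : gbin n.+1 k.+1 = gbin n k + 'X^(k.+1) * gbin n k.+1.
Proof. by []. Qed.

Lemma gbin_small n k : (n < k)%N -> gbin n k = 0.
Proof.
elim: n k => [|n ih] [|k] //= ltnk.
by rewrite !ih ?mulr0 ?addr0 //; lia.
Qed.

Lemma gbin_fact n k : (k <= n)%N ->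
  gbin n k * (euler_poly A k * euler_poly A (n - k)) = euler_poly A n.
Proof.
have E0 : euler_poly A 0 = 1 by rewrite /euler_poly big_ord0.
elim: n k => [|n ih] [|k] lekn //.
- by rewrite gbin0 E0 !mulr1.
- by rewrite gbin0 E0 subn0 !mul1r.
rewrite gbinS; move: lekn; rewrite ltnS leq_eqVlt => /orP[/eqP ->|ltkn].
  rewrite (gbin_small (ltnSn n)) mulr0 addr0 subnn E0 mulr1 euler_polyS mulrA.
  by have := ih n (leqnn n); rewrite subnn E0 mulr1 => ->.
have e1 := ih k (ltnW ltkn); have e2 := ih k.+1 ltkn.
rewrite subSS; rewrite subnS in e2.
have [m em] : exists m, (n - k = m.+1)%N by exists (n - k).-1; lia.
rewrite em /= in e1 e2 *; rewrite mulrDl.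
have -> : gbin n k * (euler_poly A k.+1 * euler_poly A m.+1)
  = (1 - 'X^(k.+1)) * (gbin n k * (euler_poly A k * euler_poly A m.+1)).
  by rewrite [euler_poly A k.+1]euler_polyS; ring.
have -> : 'X^(k.+1) * gbin n k.+1 * (euler_poly A k.+1 * euler_poly A m.+1)
  = 'X^(k.+1) * (1 - 'X^(m.+1)) * (gbin n k.+1 * (euler_poly A k.+1 * euler_poly A m)).
  by rewrite [euler_poly A m.+1]euler_polyS; ring.
rewrite e1 e2 euler_polyS; have -> : n.+1 = (k.+1 + m.+1)%N by lia.
by rewrite exprD; ring.
Qed.

(** The q-binomial theorem, homogeneous in y and z, with X in the role of q. *)
Lemma qbinomial (y z : {poly {poly A}}) n :
  \prod_(i < n) (y + z * ('X^i)%:P) =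
  \sum_(k < n.+1) (gbin n k * 'X^('C(k, 2)))%:P * y ^+ (n - k) * z ^+ k.
Proof.
elim: n z => [|n ih] z.
  by rewrite big_ord0 big_ord1 /= !mulr1.
rewrite big_ord_recl expr0 mulr1.
rewrite (eq_bigr (fun i : 'I_n => y + z * 'X%:P * ('X^i)%:P)); last first.
  by move=> i _; rewrite /bump /= exprS polyCM mulrA.
rewrite ih mulrDl [RHS]big_ord_recl gbin0 subn0 !mulr1.
rewrite [X in _ = _ + X](eq_bigr (fun k : 'I_n.+1 =>
    z * ((gbin n k * 'X^('C(k, 2)))%:P * y ^+ (n - k) * (z * 'X%:P) ^+ k) +
    (gbin n k.+1 * 'X^('C(k.+1, 2)))%:P * y ^+ (n - k) * (z * 'X%:P) ^+ k.+1)); last first.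
  move=> k _; rewrite /bump /= subSS binS bin1 !exprMn !exprD !exprS.
  by rewrite !(polyCM, polyCD) !polyC_exp; ring.
rewrite big_split /= -mulr_sumr [LHS]addrC addrCA; congr (_ + _).
rewrite [X in _ = _ + X]big_ord_recr /= gbin_small // !mul0r addr0.
rewrite big_ord_recl mulrDr mulr_sumr gbin0 subn0 !mulr1 exprS; congr (_ + _).
  by rewrite mulrCA.
apply: eq_bigr => k _; rewrite /bump /=.
by rewrite -(subnSK (ltn_ord k)) [y ^+ (_.+1)]exprS; ring.
Qed.

End GaussianBinomial.

(** * Jacobi's formula for the cube of Euler's product *)

Section Jacobi.
Variable A : idomainType.

Local Notation g := (gbin A).
Local Notation P := (euler_poly A).

Lemma prod_lower n :
  \prod_(i < n) ('X^n - 'X^i) = (-1) ^+ n * 'X^('C(n, 2)) * P n :> {poly A}.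
Proof.
rewrite (eq_bigr (fun i : 'I_n => -1 * 'X^i * (1 - 'X^(n - i)))); last first.
  move=> i _; rewrite mulrBr mulr1 -mulrA -exprD subnKC; last exact: ltnW.
  by rewrite !mulN1r opprK addrC.
rewrite !big_split /= prodr_const card_ord prodrXr -bin2_sum big_mkord.
congr (_ * _); rewrite (reindex_inj rev_ord_inj) /= /euler_poly.
by apply: eq_bigr => i _; rewrite subKn.
Qed.

Lemma prod_upper n :
  \prod_(i < n) ('X^n - 'X^(n.+1 + i)) = 'X^(n * n) * P n :> {poly A}.
Proof.
rewrite (eq_bigr (fun i : 'I_n => 'X^n * (1 - 'X^(i.+1)))); last first.
  by move=> i _; rewrite mulrBr mulr1 -exprD addnS addSn.
by rewrite big_split /= prodr_const card_ord -exprM.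
Qed.

(** The exponent m(m+1)/2 that goes with the index k = n + 1 + m of a sum over
    k <= 2n+1; the integer m may be negative, and m and -1 - m give the same
    exponent. *)
Definition jacobi_exp n k : nat := if (n < k)%N then 'C(k - n, 2) else 'C(n.+1 - k, 2).

Lemma bin2_double m : ('C(m, 2) * 2 + m = m * m)%N.
Proof. by case: m => // m; rewrite mulnC -mul_bin_diag bin1 /= mulnS addnC. Qed.

Lemma jacobi_expE n k : (k < (n + n.+1).+1)%N ->
  ('C(k, 2) + n * (n + n.+1 - k) = n + 'C(n, 2) + n * n + jacobi_exp n k)%N.
Proof.
move=> ltk; rewrite /jacobi_exp; case: ltnP => hk.
  have [m [d [-> ->]]] : exists m d, k = (m + m + d + 1)%N /\ n = (m + d)%N.
    by exists (k - n.+1)%N, (n - (k - n.+1))%N; split; lia.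
  have -> : (m + d + (m + d).+1 - (m + m + d + 1) = d)%N by lia.
  have -> : (m + m + d + 1 - (m + d) = m + 1)%N by lia.
  have := bin2_double (m + m + d + 1); have := bin2_double (m + d).
  by have := bin2_double (m + 1); clear; lia.
have [m ->] : exists m, n = (k + m)%N by exists (n - k)%N; lia.
have -> : (k + m + (k + m).+1 - k = k + m + m + 1)%N by lia.
have -> : ((k + m).+1 - k = m + 1)%N by lia.
have := bin2_double k; have := bin2_double (k + m).
by have := bin2_double (m + 1); clear; lia.
Qed.

(** Take y = X^n and z = -Z in the q-binomial theorem for 2n+1 factors. The
    factor of index n is X^n (1 - Z), so the derivative in Z at Z = 1 is, up to
    sign and a power of X, the product of the values of the others, which is the
    square of the n-th partial product. *)
Lemma jacobi_finite n :
  (-1) ^+ n.+1 * P n ^+ 2 =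
  \sum_(k < (n + n.+1).+1) (-1) ^+ k * 'X^(jacobi_exp n k) * g (n + n.+1) k *+ k.
Proof.
(* L and U collect the factors of index below and above n. *)
pose L : {poly {poly A}} := \prod_(i < n) (('X^n)%:P + - 'X * ('X^i)%:P).
pose U : {poly {poly A}} :=
  \prod_(i < n) (('X^n)%:P + - 'X * ('X^(n.+1 + i))%:P).
have prodE : \prod_(i < n + n.+1) (('X^n)%:P + - 'X * ('X^i)%:P) =
    (1 - 'X) * (('X^n)%:P * L * U) :> {poly {poly A}}.
  rewrite big_split_ord /= big_ord_recl /= addn0 -/L.
  rewrite (eq_bigr (fun i : 'I_n => ('X^n)%:P + - 'X * ('X^(n.+1 + i))%:P)) -/U; last first.
    by move=> i _; rewrite /bump /= addnS addSn.
  ring.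
have L1 : L.[1] = (-1) ^+ n * 'X^('C(n, 2)) * P n.
  rewrite -prod_lower horner_prod; apply: eq_bigr => i _.
  by rewrite !hornerE mulN1r.
have U1 : U.[1] = 'X^(n * n) * P n.
  rewrite -prod_upper horner_prod; apply: eq_bigr => i _.
  by rewrite !hornerE mulN1r.
have lhs1 : (((1 - 'X) * (('X^n)%:P * L * U))^`()).[1] = - ('X^n * L.[1] * U.[1]).
  rewrite derivM derivB derivX -[1]/(1%:P) derivC sub0r.
  by rewrite hornerD !hornerM hornerN !hornerC hornerD hornerN hornerX hornerC; ring.
have rhs1 k : (((g (n + n.+1) k * 'X^('C(k, 2)))%:P * ('X^n)%:P ^+ (n + n.+1 - k) *
     (- 'X) ^+ k)^`()).[1] =
   (-1) ^+ k * ('X^('C(k, 2) + n * (n + n.+1 - k)) * g (n + n.+1) k) *+ k.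
  have -> : (- 'X : {poly {poly A}}) ^+ k = ((-1) ^+ k)%:P * 'X^k.
    by rewrite [LHS]exprNn polyC_exp polyCN.
  rewrite -polyC_exp mulrA -!polyCM mul_polyC derivZ derivXn hornerZ hornerMn.
  rewrite hornerXn expr1n mulrnAr mulr1; congr (_ *+ k).
  by rewrite exprD exprM; ring.
have X0 : 'X^(n + 'C(n, 2) + n * n) != 0 :> {poly A} by rewrite expf_neq0 // polyX_eq0.
apply: (mulfI X0).
transitivity (- ('X^n * L.[1] * U.[1])).
  by rewrite L1 U1 !exprD exprS; ring.
rewrite -lhs1 -prodE qbinomial raddf_sum /= horner_sum mulr_sumr.
apply: eq_bigr => k _; rewrite rhs1 jacobi_expE // [RHS]mulrnAr exprD.
by congr (_ *+ _); ring.
Qed.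

(** By the factorial formula, the Gaussian binomial coefficient times a
    partial product is 1 modulo X^(m+1), with m the smaller of k and N - k. *)
Lemma gbin_euler n N k : (k <= N)%N -> (minn k (N - k) <= n)%N ->
  eqX (minn k (N - k)).+1 (g N k * P n) 1.
Proof.
move=> lekN; set m := minn _ _ => lemn.
have Pm j : (m <= j)%N -> eqX m.+1 (P j) (P m) by exact: euler_poly_trunc.
suff h : eqX m.+1 (P m * (g N k * P n - 1)) 0.
  move=> i lti; have /eqP := eqX_cancel (coef0_euler_poly A m) h lti.
  by rewrite coefB coef0 subr_eq0 => /eqP.
move=> i lti; rewrite mulrBr mulr1 coefB coef0; apply/eqP; rewrite subr_eq0; apply/eqP.
have e : eqX m.+1 (g N k * (P k * P (N - k))) (P m).
  by rewrite gbin_fact //; apply: Pm; rewrite /m; lia.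
rewrite -(e i lti).
rewrite mulrCA; apply: eqXM lti => //; apply: eqX_sym.
by apply: eqXM; [apply: eqX_trans (eqX_sym (Pm _ _)) | apply: eqX_trans (eqX_sym (Pm _ _))] => //;
   apply: Pm; rewrite /m; lia.
Qed.

(** Grouping the terms k = n + 1 + m and k = n - m, with 0 <= m <= n, gives the
    usual coefficient 2m + 1 at m(m+1)/2. *)
Lemma jacobi_trunc n :
  eqX n.+1 ((-1) ^+ n.+1 * P n ^+ 3)
    (\sum_(k < (n + n.+1).+1) (-1) ^+ k * 'X^(jacobi_exp n k) *+ k).
Proof.
rewrite [_ ^+ 3]exprSr mulrA jacobi_finite mulr_suml; apply: eqX_sum => k _.
rewrite mulrnAl -mulrA -mulrA -[_ *+ k]mulrnAl -[X in eqX _ _ X]mulrnAl; apply: eqXM => //.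
have ltk : (k < (n + n.+1).+1)%N := ltn_ord k.
set m := minn k (n + n.+1 - k).
(* The congruence of the Gaussian factor, shifted by the exponent, is precise enough. *)
have hm : (n <= m + jacobi_exp n k)%N.
  rewrite /m /jacobi_exp; case: (ltnP n k) => hk.
    have -> : minn k (n + n.+1 - k) = (n - (k - n.+1))%N by lia.
    have -> : (k - n = (k - n.+1).+1)%N by lia.
    by rewrite binS bin1; lia.
  have -> : minn k (n + n.+1 - k) = k by lia.
  have -> : (n.+1 - k = (n - k).+1)%N by lia.
  by rewrite binS bin1; lia.
move=> i lti; rewrite coefXnM coefXn; case: ltnP => hi; first by rewrite ltn_eqF.
have lekN : (k <= n + n.+1)%N by [].
have lemn : (m <= n)%N by rewrite /m; lia.
rewrite (gbin_euler lekN lemn); last by lia.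
by rewrite coef1; congr (_%:R); lia.
Qed.

End Jacobi.

(** * Arithmetic modulo 5 *)

Lemma Fp5_0 : 5%:R = 0 :> 'F_5.
Proof. exact: pchar_Fp_0. Qed.

(** For n = 2 modulo 5 the term of index k = n + 1 + m has the coefficient
    k = m + 3 modulo 5, which vanishes when m = 2 modulo 5; in all other cases
    m(m+1)/2 is 0 or 1 modulo 5. *)
Lemma euler_cube_support5 n i : (n %% 5 = 2)%N -> (i <= n)%N ->
  (1 < i %% 5)%N -> (euler_poly 'F_5 n ^+ 3)`_i = 0.
Proof.
move=> n5 lein i5; have h := @jacobi_trunc 'F_5 n i lein.
suff : ((-1) ^+ n.+1 * euler_poly 'F_5 n ^+ 3)`_i = 0.
  rewrite -signr_odd mulr_sign; case: ifP => // _.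
  by rewrite coefN => /eqP; rewrite oppr_eq0 => /eqP.
rewrite {}h coef_sum big1 // => k _; rewrite coefMn.
have [k5|k5] := boolP (5 %| k)%N.
  by case/dvdnP: k5 => c ->; rewrite mulrnA -mulr_natr Fp5_0 mulr0.
rewrite -signr_odd mulr_sign.
suff /negPf ne : i != jacobi_exp n k by case: ifP => _; rewrite ?coefN coefXn ne ?oppr0 mul0rn.
apply/eqP => ei; move: i5; rewrite ei /jacobi_exp.
have ltk : (k < (n + n.+1).+1)%N := ltn_ord k.
have tri5 m : (m %% 5 != 3)%N -> ('C(m, 2) %% 5 <= 1)%N.
  have := bin2_double m; move: 'C(m, 2) => c.
  have -> : (m * m = 25 * ((m %/ 5) * (m %/ 5)) +
      10 * ((m %/ 5) * (m %% 5)) + (m %% 5) * (m %% 5))%N.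
    by rewrite {1 2}(divn_eq m 5); ring.
  have : (m %% 5 < 5)%N by rewrite ltn_mod.
  have := divn_eq m 5; move: (m %/ 5)%N (m %% 5)%N => a b ->.
  by case: b => [|[|[|[|[|]]]]] //; lia.
by case: (ltnP n k) => hk; apply/negP; rewrite -leqNgt; apply: tri5; move: k5; lia.
Qed.

Lemma frobenius5 (p : {poly 'F_5}) : p ^+ 5 = p \Po 'X^5.
Proof.
have ch : 5%N \in [pchar {poly 'F_5}] by rewrite pchar_poly; exact: pchar_Fp.
have c5 (c : 'F_5) : c ^+ 5 = c by rewrite -[in RHS](expf_card c) card_Fp.
elim/poly_ind: p => [|p c ih]; first by rewrite comp_poly0 expr0n.
rewrite -!(pFrobenius_autE ch) rmorphD rmorphM /= in ih *.
rewrite comp_polyD comp_polyM comp_polyX comp_polyC !pFrobenius_autE in ih *.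
by rewrite ih -polyC_exp c5.
Qed.

Lemma frobenius25 (p : {poly 'F_5}) : p ^+ 25 = (p \Po 'X^5) \Po 'X^5.
Proof. by rewrite -!frobenius5 -exprM. Qed.

Section Mod5.
Variables (N : nat).
Hypothesis N5 : (N %% 5 = 2)%N.

Local Notation f := (euler_poly 'F_5 N).
Local Notation f2 := (f \Po 'X^2).

(** Among the exponents 5i+3 of f_1 f_2, only those with 5 | i occur. *)
Lemma sect3_euler M : (25 * M <= N)%N ->
  eqX (5 * M) (sect 5 3 (f2 * f)) (sect 5 0 (sect 5 3 (f2 * f)) \Po 'X^5).
Proof.
move=> leMN i lti; rewrite coef_comp_poly_Xn // [in RHS]coef_sect //.
case: ifP => [/dvdnP [c ->]|i5]; first by rewrite mulnK // addn0 mulnC.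
rewrite coef_sect // coefM big1 // => j _; rewrite coef_comp_poly_Xn //.
have ltj := ltn_ord j.
case: ifP => [/dvdnP [a ea]|_]; last by rewrite mul0r.
rewrite ea mulnK //.
have [ha|na] := boolP ((a %% 5 <= 2) && ((a %% 5 == 1) ==> (a %% 25 == 1)))%N;
  last by rewrite (euler_poly_support5 _ _ na) ?mul0r //; lia.
rewrite mulrC euler_poly_support5 ?mul0r //; first by lia.
by lia.
Qed.

Lemma sect4_euler4 M : (25 * M <= N)%N -> eqX M (sect 5 4 (f ^+ 4)) 0.
Proof.
move=> leMN i lti; rewrite coef_sect // exprS coefM coef0 big1 // => j _.
have ltj := ltn_ord j.
have [ha|na] := boolP ((j %% 5 <= 2) && ((j %% 5 == 1) ==> (j %% 25 == 1)))%N;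
  last by rewrite (euler_poly_support5 _ _ na) ?mul0r //; lia.
rewrite euler_cube_support5 ?mulr0 //; lia.
Qed.

Lemma sect1_euler23 M : (25 * M <= N)%N -> eqX M (sect 5 1 (f2 ^+ 3)) 0.
Proof.
move=> leMN i lti; rewrite coef_sect // -rmorphXn /= coef_comp_poly_Xn // coef0.
by case: ifP => // h; rewrite euler_cube_support5 //; lia.
Qed.

(** The coefficients at 5(5i+4)+3 = 25i+23 of a solution D of
    f_1^(3K+1) D = f_2^K modulo X^N, for K = 25k+1. *)
Lemma coef_23 k M (D : {poly 'F_5}) : (25 * M <= N)%N ->
  eqX N (f ^+ (3 * (25 * k + 1) + 1) * D) (f2 ^+ (25 * k + 1)) ->
  eqX M (sect 5 4 (sect 5 3 D)) 0.
Proof.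
move=> leMN h.
(* Multiplication by f_1 makes the powers multiples of 5 and 25, up to f_1 f_2. *)
have {}h : eqX N ((((f ^+ (3 * k) \Po 'X^5) * f) \Po 'X^5) * D)
                 (((f2 ^+ k \Po 'X^5) \Po 'X^5) * (f2 * f)).
  have -> : (((f ^+ (3 * k) \Po 'X^5) * f) \Po 'X^5) * D =
      f * (f ^+ (3 * (25 * k + 1) + 1) * D).
    rewrite rmorphM /= -frobenius25 -frobenius5 -exprM mulrA -exprD -exprS.
    by congr (_ ^+ _ * _); lia.
  have -> : ((f2 ^+ k \Po 'X^5) \Po 'X^5) * (f2 * f) = f * f2 ^+ (25 * k + 1).
    by rewrite -frobenius25 -exprM mulrA -exprSr mulrC; congr (_ * _ ^+ _); lia.
  exact: eqXM.
have {}h := sect_eqX (m := 5) (n := 5 * M) (r := 3) isT isT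
  (leq_trans (eq_leq (mulnA 5 5 M)) leMN) h.
rewrite !sect_compM // in h.
have {}h := eqX_trans h (eqXM (eqX_refl _) (sect3_euler leMN)).
set G := sect 5 0 _ in h.
(* Multiplication by f_1^4 makes the left factor a polynomial in X^5 again. *)
have {}h : eqX (5 * M) ((f ^+ (3 * k) * f \Po 'X^5) * sect 5 3 D)
                       ((f2 ^+ k * G \Po 'X^5) * f ^+ 4).
  rewrite !rmorphM /= -[f \Po 'X^5]frobenius5.
  rewrite (_ : _ * f ^+ 5 * _ = (f ^+ (3 * k) \Po 'X^5) * f * sect 5 3 D * f ^+ 4); last by ring.
  exact: eqXM.
have {}h := sect_eqX (m := 5) (n := M) (r := 4) isT isT (leqnn _) h.
rewrite !sect_compM // -exprSr in h.
apply: (eqX_cancel (p := f ^+ (3 * k).+1)).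
  exact: coef0_euler_polyX.
apply: eqX_trans h _; rewrite -[X in eqX _ _ X](mulr0 (f2 ^+ k * G)).
by apply: eqXM => //; apply: sect4_euler4.
Qed.

(** The coefficients at 5(5i+1)+3 = 25i+8, for K = 75k+16. *)
Lemma coef_8 k M (D : {poly 'F_5}) : (25 * M <= N)%N ->
  eqX N (f ^+ (3 * (75 * k + 16) + 1) * D) (f2 ^+ (75 * k + 16)) ->
  eqX M (sect 5 1 (sect 5 3 D)) 0.
Proof.
move=> leMN h.
(* Multiplication by f_1 makes the powers multiples of 5 and 25, up to f_1 f_2. *)
have {}h : eqX N (((f ^+ (9 * k + 2) \Po 'X^5) \Po 'X^5) * D)
                 ((((f2 ^+ (3 * k) \Po 'X^5) * f2 ^+ 3) \Po 'X^5) * (f2 * f)).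
  have -> : ((f ^+ (9 * k + 2) \Po 'X^5) \Po 'X^5) * D =
      f * (f ^+ (3 * (75 * k + 16) + 1) * D).
    rewrite -frobenius25 -exprM mulrA -exprS.
    by congr (_ ^+ _ * _); lia.
  have -> : (((f2 ^+ (3 * k) \Po 'X^5) * f2 ^+ 3) \Po 'X^5) * (f2 * f) = f * f2 ^+ (75 * k + 16).
    rewrite rmorphM /= -frobenius25 -[(f2 ^+ 3) \Po _]frobenius5 -!exprM.
    rewrite -exprD mulrA -exprSr mulrC; congr (_ * _ ^+ _); lia.
  exact: eqXM.
have {}h := sect_eqX (m := 5) (n := 5 * M) (r := 3) isT isT
  (leq_trans (eq_leq (mulnA 5 5 M)) leMN) h.
rewrite !sect_compM // in h.
have {}h := eqX_trans h (eqXM (eqX_refl _) (sect3_euler leMN)).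
set G := sect 5 0 _ in h.
have {}h : eqX (5 * M) ((f ^+ (9 * k + 2) \Po 'X^5) * sect 5 3 D)
                       ((f2 ^+ (3 * k) * G \Po 'X^5) * f2 ^+ 3).
  by rewrite [(_ * G) \Po _]rmorphM /= mulrAC.
have {}h := sect_eqX (m := 5) (n := M) (r := 1) isT isT (leqnn _) h.
rewrite !sect_compM // in h.
apply: (eqX_cancel (p := f ^+ (9 * k + 2))).
  exact: coef0_euler_polyX.
apply: eqX_trans h _; rewrite -[X in eqX _ _ X](mulr0 (f2 ^+ (3 * k) * G)).
by apply: eqXM => //; apply: sect1_euler23.
Qed.

End Mod5.

(** * From sums of series to polynomials *)

Local Open Scope classical_set_scope.

Section Analytic.
Variable R : realType.
Implicit Types (t : R) (f g : R -> R).

(** The topology on the complex side is that of the norm with complex values. *)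
Lemma cvg_real_complex (u : nat -> R) (l : R) :
  (fun n => (u n)%:C%C : R[i]^o) @ \oo --> (l%:C%C : R[i]^o) <->
  u @ \oo --> l.
Proof.
have nE (x y : R) : `|x%:C%C - y%:C%C| = (`|x - y|)%:C%C :> R[i].
  by rewrite -rmorphB normc_def /= expr0n addr0 sqrtr_sqr.
split=> [/cvgrPdist_lt h | /cvgrPdist_lt h]; apply/cvgrPdist_lt => e e0.
  have /h : (0 < e%:C%C :> R[i]) by rewrite ltcR.
  by apply: filterS => n; rewrite nE ltcR.
have eR : e = (complex.Re e)%:C%C.
  by move: e0; case: e => a b; rewrite ltcE /= => /andP[/eqP -> _].
move: e0; rewrite eR ltcR => /h.
by apply: filterS => n; rewrite nE ltcR.
Qed.

Lemma horner_euler_polyS t n :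
  (euler_poly R n.+1).[t] = (euler_poly R n).[t] * (1 - t ^+ n.+1).
Proof. by rewrite euler_polyS hornerM !hornerE. Qed.

Lemma euler_poly_horner_ge0 t n : 0 <= t <= 2^-1 -> 0 <= (euler_poly R n).[t] <= 1.
Proof.
move=> /andP[t0 t1]; elim: n => [|n /andP[h0 h1]].
  by rewrite /euler_poly big_ord0 hornerC ler01 lexx.
rewrite horner_euler_polyS.
have tn0 : 0 <= t ^+ n.+1 by rewrite exprn_ge0.
have tn1 : t ^+ n.+1 <= 1 by rewrite exprn_ile1 //; lra.
by apply/andP; split; [apply: mulr_ge0; lra | nra].
Qed.

Lemma euler_poly_horner_decr t : 0 <= t <= 2^-1 ->
  {homo (fun n => (euler_poly R n).[t]) : n m / (n <= m)%N >-> m <= n}.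
Proof.
move=> ht; apply: homo_leq => [x|x y z h1 h2|n]; [exact: lexx|exact: le_trans h2 h1|].
rewrite horner_euler_polyS; have := euler_poly_horner_ge0 n ht; case/andP: ht => t0 t1.
have tn0 : 0 <= t ^+ n.+1 by rewrite exprn_ge0.
move=> /andP[h0 h1]; nra.
Qed.

(** With [euler_poly_horner_decr], this encloses the limit of the partial products
    within 2 t^(n+1) of the n-th one. *)
Lemma euler_poly_horner_incr t : 0 <= t <= 2^-1 ->
  {homo (fun n => (euler_poly R n).[t] - 2 * t ^+ n.+1) : n m / (n <= m)%N >-> n <= m}.
Proof.
move=> ht; apply: homo_leq => [x|x y z h1 h2|n]; [exact: lexx|exact: le_trans h1 h2|].
rewrite horner_euler_polyS; have := euler_poly_horner_ge0 n ht; case/andP: ht => t0 t1.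
have tn0 : 0 <= t ^+ n.+1 by rewrite exprn_ge0.
rewrite [t ^+ n.+2]exprS; move=> /andP[h0 h1]; nra.
Qed.

(** The value f_1(t) of Euler's infinite product at a real number t. *)
Definition euler t : R := limn (fun n => (euler_poly R n).[t]).

Lemma cvg_euler t : 0 <= t <= 2^-1 ->
  (fun n => (euler_poly R n).[t]) @ \oo --> euler t.
Proof.
move=> ht; apply: nonincreasing_is_cvgn; first exact: euler_poly_horner_decr.
by exists 0 => _ [n _ <-]; case/andP: (euler_poly_horner_ge0 n ht).
Qed.

Lemma euler_bounds t n : 0 <= t <= 2^-1 ->
  (euler_poly R n).[t] - 2 * t ^+ n.+1 <= euler t <= (euler_poly R n).[t].
Proof.
move=> ht; apply/andP; split.
  apply: (cvgr_to_ge (cvg_euler ht)); exists n => // m /= nm.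
  have := euler_poly_horner_incr ht nm => /= h; apply: (le_trans h).
  by rewrite gerBl mulr_ge0 // exprn_ge0 //; case/andP: ht.
apply: (cvgr_to_le (cvg_euler ht)); exists n => // m /= nm.
exact: (euler_poly_horner_decr ht nm).
Qed.

Lemma qpochhammer_real t : 0 <= t <= 2^-1 ->
  qpochhammer t%:C%C t%:C%C = (euler t)%:C%C.
Proof.
move=> ht; apply: (@cvg_lim R[i]^o); first exact: norm_hausdorff.
have /cvg_real_complex := cvg_euler ht; apply: cvg_trans.
apply: near_eq_cvg; near=> n.
rewrite /euler_poly horner_prod rmorph_prod; apply: eq_bigr => i _.
by rewrite !hornerE exprS rmorphB rmorph1 rmorphM rmorphXn.
Unshelve. all: by end_near. Qed.

(** f - g = O(t^n) uniformly on ]0, 1/8]. *)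
Definition eqO n f g : Prop :=
  exists C : R, forall t, 0 < t <= 8^-1 -> `|f t - g t| <= C * t ^+ n.

(** Boundedness on ]0, 1/8]. *)
Definition bounded8 f : Prop := exists C : R, forall t, 0 < t <= 8^-1 -> `|f t| <= C.

Lemma eqO_sym n f g : eqO n f g -> eqO n g f.
Proof. by move=> [C h]; exists C => t ht; rewrite distrC h. Qed.

Lemma eqO_eq n f g : (forall t, 0 < t <= 8^-1 -> f t = g t) -> eqO n f g.
Proof. by move=> h; exists 0 => t ht; rewrite h // subrr normr0 mul0r. Qed.

Lemma eqO_trans n f g h : eqO n f g -> eqO n g h -> eqO n f h.
Proof.
move=> [C hC] [D hD]; exists (C + D) => t ht.
apply: (le_trans (ler_distD (g t) _ _)).
by rewrite mulrDl lerD ?hC ?hD.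
Qed.

Lemma eqO_mul n f g f' g' : bounded8 f -> bounded8 g' ->
  eqO n f f' -> eqO n g g' -> eqO n (fun t => f t * g t) (fun t => f' t * g' t).
Proof.
move=> [C hC] [D hD] [E hE] [F hF]; exists (C * F + E * D) => t ht.
have -> : f t * g t - f' t * g' t = f t * (g t - g' t) + (f t - f' t) * g' t.
  by ring.
apply: (le_trans (ler_normD _ _)); rewrite !normrM mulrDl -!mulrA.
apply: lerD; first by rewrite ler_pM ?hC ?hF.
by rewrite [D * _]mulrC mulrA ler_pM ?hE ?hD.
Qed.

Lemma bounded8M f g : bounded8 f -> bounded8 g -> bounded8 (fun t => f t * g t).
Proof.
move=> [C hC] [D hD]; exists (C * D) => t ht.
by rewrite normrM ler_pM ?hC ?hD.
Qed.

Lemma bounded8X f k : bounded8 f -> bounded8 (fun t => f t ^+ k).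
Proof.
move=> hf; elim: k => [|k ih]; first by exists 1 => t _; rewrite normr1.
have [C hC] := bounded8M hf ih; exists C => t ht.
by rewrite exprS; apply: hC.
Qed.

Lemma eqOX n k f g : bounded8 f -> bounded8 g ->
  eqO n f g -> eqO n (fun t => f t ^+ k) (fun t => g t ^+ k).
Proof.
move=> bf bg fg; elim: k => [|k ih].
  by exists 0 => t ht; rewrite !expr0 subrr normr0 mul0r.
have [C hC] := eqO_mul bf (bounded8X k bg) fg ih; exists C => t ht.
by rewrite !exprS; apply: hC.
Qed.

Lemma bounded8_poly (p : {poly R}) : bounded8 (fun t => p.[t]).
Proof.
exists (\sum_(i < size p) `|p`_i|) => t /andP[t0 t1].
rewrite horner_coef; apply: (le_trans (ler_norm_sum _ _ _)).
apply: ler_sum => i _; rewrite normrM ler_piMr // normrX.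
by rewrite exprn_ile1 // ger0_norm; lra.
Qed.

Lemma eqO_bounded8 n f g : eqO n f g -> bounded8 g -> bounded8 f.
Proof.
move=> [C hC] [D hD]; exists (`|C| + D) => t ht.
have -> : f t = (f t - g t) + g t by ring.
apply: (le_trans (ler_normD _ _)); rewrite lerD ?hD //.
apply: (le_trans (hC _ ht)); apply: (le_trans (ler_norm _)).
rewrite normrM ler_piMr // normrX; case/andP: ht => t0 t1.
by rewrite exprn_ile1 // ger0_norm; lra.
Qed.

(** A polynomial that is O(t^n) near 0 has no coefficient below n. *)
Lemma eqO_poly_coef n (p q : {poly R}) :
  eqO n (fun t => p.[t]) (fun t => q.[t]) ->
  forall i, (i < n)%N -> p`_i = q`_i.
Proof.
move=> [C hC] i ltin; apply/eqP; rewrite -subr_eq0 -coefB; apply/eqP.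
have {}hC t : 0 < t <= 8^-1 -> `|(p - q).[t]| <= C * t ^+ n.
  by move=> ht; rewrite hornerD hornerN; apply: hC.
move: (p - q : {poly R}) hC => {p q} p.
elim: n i ltin p => // n ih i ltin p hC.
pose r := drop_poly 1 p.
have pE : p = r * 'X + (p`_0)%:P.
  apply/polyP => -[|j]; rewrite coefD coefC coefMX coef_drop_poly /=.
    by rewrite add0r.
  by rewrite addn1 addr0.
(* For 0 < t <= 1/8 and D a bound for r, |p_0| <= (|C| + |D|) t; let t be small. *)
have p0 : p`_0 = 0.
  have [D hD] := bounded8_poly r.
  apply/eqP; case: eqP => // /eqP p0; exfalso.
  set c : R := `|p`_0|; have c0 : 0 < c by rewrite normr_gt0.
  set E : R := `|C| + `|D| + 1.
  have E0 : 0 < E by rewrite /E; have := normr_ge0 C; have := normr_ge0 D; lra.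
  pose t := Num.min (8^-1) (c / (2 * E)).
  have t0 : 0 < t by rewrite lt_min; apply/andP; split; [lra | rewrite divr_gt0 // mulr_gt0].
  have t8 : t <= 8^-1 by rewrite ge_min lexx.
  have tc : E * t <= c / 2.
    apply: (@le_trans _ R (E * (c / (2 * E)))).
      by rewrite ler_pM2l // ge_min lexx orbT.
    by rewrite le_eqVlt; apply/orP; left; apply/eqP; clear -E0; field; rewrite gt_eqF.
  have ht : 0 < t <= 8^-1 by rewrite t0 t8.
  have h1 : `|p.[t]| <= `|C| * t.
    apply: (le_trans (hC _ ht)); apply: (@le_trans _ R (`|C| * t ^+ n.+1)).
      by rewrite ler_wpM2r ?ler_norm ?exprn_ge0 // ltW.
    by rewrite ler_wpM2l // exprS ler_piMr ?exprn_ile1 //; lra.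
  have h2 : `|r.[t] * t| <= `|D| * t.
    rewrite normrM (gtr0_norm t0) ler_wpM2r ?(ltW t0) //.
    by apply: (le_trans (hD _ ht)); rewrite ler_norm.
  have h3 : p`_0 = p.[t] - r.[t] * t by rewrite {2}pE !hornerE; ring.
  have h4 : c <= `|C| * t + `|D| * t.
    by rewrite /c h3; apply: (le_trans (ler_normB _ _)); rewrite lerD.
  have : (`|C| + `|D| + 1) * t <= c / 2 by [].
  by rewrite !mulrDl mul1r; lra.
case: i ltin => [//|i] ltin.
have -> : p`_i.+1 = r`_i by rewrite coef_drop_poly addn1.
apply: (ih _ _ r) => // t /[dup] ht /andP[t0 t8].
have := hC _ ht; rewrite {1}pE p0 !hornerE normrM (gtr0_norm t0).
by rewrite exprSr mulrA ler_pM2r.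
Qed.

Lemma eqO_euler n : eqO n euler (fun t => (euler_poly R n).[t]).
Proof.
exists 2 => t /andP[t0 t1]; have ht : 0 <= t <= 2^-1 by lra.
have /andP[h1 h2] := euler_bounds n ht.
have tn0 : 0 <= t ^+ n by rewrite exprn_ge0 // ltW.
rewrite distrC ger0_norm; last by lra.
by move: h1; rewrite exprS; nra.
Qed.

Lemma eqO_euler2 n :
  eqO n (fun t => euler (t ^+ 2)) (fun t => (euler_poly R n \Po 'X^2).[t]).
Proof.
exists 2 => t /andP[t0 t1].
have ht : 0 <= t ^+ 2 <= 2^-1 by nra.
have /andP[h1 h2] := euler_bounds n ht.
have tn0 : 0 <= t ^+ n by rewrite exprn_ge0 // ltW.
rewrite horner_comp hornerXn distrC ger0_norm; last by lra.
suff : (t ^+ 2) ^+ n.+1 <= t ^+ n by lra.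
rewrite -exprM ler_wiXn2l //; [lra|lra|lia].
Qed.

(** Convergence at 1/4 bounds a_j by C 4^j, and on ]0, 1/8] the tail from n is
    then at most twice C (4 t)^n. *)
Lemma eqO_series (a : nat -> R) (D : R -> R) n :
  (forall t, 0 < t <= 4^-1 -> series (fun j => a j * t ^+ j) @ \oo --> D t) ->
  eqO n D (fun t => (\poly_(j < n) a j).[t]).
Proof.
move=> hD.
have [C C0 hC] : exists2 C : R, 0 <= C & forall j, `|a j| <= C * 4 ^+ j.
  have h4 : 0 < (4^-1 : R) <= 4^-1 by lra.
  have /cvg_seq_bounded [M [Mr hM]] : cvgn (fun j => a j * 4^-1 ^+ j : R).
    by apply/cvg_ex; exists 0; apply: cvg_series_cvg_0; apply/cvg_ex; exists (D 4^-1); exact: hD.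
  exists (`|M| + 1) => [|j]; first by have := normr_ge0 M; lra.
  have : `|a j * 4^-1 ^+ j| <= `|M| + 1.
    by apply: hM => //; have := ler_norm M; lra.
  rewrite normrM normrX (ger0_norm (x := 4^-1 : R)) ?invr_ge0 //.
  by rewrite exprVn ler_pdivrMr ?exprn_gt0.
exists (C * 4 ^+ n * 2) => t /andP[t0 t8].
have ht : 0 < t <= 4^-1 by lra.
have -> : (\poly_(j < n) a j).[t] = series (fun j => a j * t ^+ j) n.
  by rewrite horner_poly /series /= big_mkord.
have tail m : (n <= m)%N ->
  `|series (fun j => a j * t ^+ j) m - series (fun j => a j * t ^+ j) n|
    <= C * 4 ^+ n * 2 * t ^+ n - C * 2 * (4 * t) ^+ m.
  move=> /subnK <-; elim: (m - n)%N => [|k ih].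
    by rewrite add0n subrr normr0 exprMn; lra.
  rewrite addSn /series /= big_nat_recr //= -/(series _ _) addrAC.
  apply: (le_trans (ler_normD _ _)).
  set s := (k + n)%N in ih *; rewrite exprS.
  have : `|a s * t ^+ s| <= C * (4 * t) ^+ s.
    rewrite normrM normrX (gtr0_norm t0) exprMn mulrA.
    by rewrite ler_wpM2r ?exprn_ge0 ?(ltW t0) ?hC.
  have : 0 <= C * (4 * t) ^+ s by rewrite mulr_ge0 ?exprn_ge0 //; lra.
  set X := (4 * t) ^+ s => ? ?.
  move: ih; rewrite /series /=. set Y := `|\sum_(0 <= _ < s) _ - _| => ih.
  have : 0 <= C * X * (1 - 8 * t) by apply: mulr_ge0; lra.
  by rewrite -/X in ih; lra.
have tail' m : (n <= m)%N ->
  `|series (fun j => a j * t ^+ j) m - series (fun j => a j * t ^+ j) n|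
    <= C * 4 ^+ n * 2 * t ^+ n.
  move=> /tail h; apply: (le_trans h); rewrite gerBl.
  by rewrite !mulr_ge0 ?exprn_ge0 //; lra.
have cv := cvg_norm (cvgB (hD _ ht)
  (cvg_cst (series (fun j => a j * t ^+ j) n))).
by apply: (cvgr_to_le (cv _ _ _)); exists n => // m /= nm; exact: tail'.
Qed.

Lemma is_d_real d k t : is_d R d -> 0 < t <= 4^-1 ->
  series (fun j => (d k j)%:~R * t ^+ j) @ \oo -->
    euler (t ^+ 2) ^+ k / euler t ^+ (3 * k + 1).
Proof.
move=> hd /andP[t0 t4].
have h1 : 0 <= t <= 2^-1 by lra.
have h2 : 0 <= t ^+ 2 <= 2^-1 by nra.
have nt : `|t%:C%C| < 1 :> R[i].
  by rewrite normc_def /= expr0n addr0 sqrtr_sqr (gtr0_norm t0) (ltcR _ 1); lra.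
have := hd k _ nt; rewrite -rmorphXn (qpochhammer_real h1) (qpochhammer_real h2).
rewrite -!rmorphXn -fmorphV -rmorphM /= => h.
apply/cvg_real_complex; apply: cvg_trans h; apply: near_eq_cvg; near=> n.
rewrite /series /= rmorph_sum; apply: eq_bigr => i _.
by rewrite rmorphM rmorphXn rmorph_int.
Unshelve. all: by end_near. Qed.

Lemma euler_gt0 t : 0 < t <= 4^-1 -> 0 < euler t.
Proof.
move=> ht; have h1 : 0 <= t <= 2^-1 by lra.
have /andP[h _] := euler_bounds 0 h1.
by move: h; rewrite /euler_poly big_ord0 hornerC expr1; lra.
Qed.

End Analytic.

(** The polynomial form of the definition of the d_k: the product of
    f_1^(3k+1) and of the series of the d_k is f_2^k, modulo X^n. *)
Lemma is_d_poly (R : realType) d k n : is_d R d ->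
  eqX n (euler_poly int n ^+ (3 * k + 1) * \poly_(j < n) d k j)
    ((euler_poly int n \Po 'X^2) ^+ k).
Proof.
move=> hd i ltin; apply: (@intr_inj R).
rewrite -!(coef_map (intmul 1 : {rmorphism int -> R})) /=.
rewrite rmorphM !rmorphXn /= map_comp_poly map_polyXn !map_euler_poly.
have -> : map_poly intr (\poly_(j < n) d k j) = \poly_(j < n) (d k j)%:~R :> {poly R}.
  by apply/polyP => j; rewrite coef_map !coef_poly; case: ifP.
apply: (eqO_poly_coef (n := n)) => //.
set D := fun t : R => euler (t ^+ 2) ^+ k / euler t ^+ (3 * k + 1).
have hD := eqO_series (D := D) n (fun t => @is_d_real R d k t hd).
have h1 := eqO_euler R n; have h2 := eqO_euler2 R n.
have b1 := bounded8_poly (euler_poly R n).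
have b2 := bounded8_poly (euler_poly R n \Po 'X^2).
have b1' := eqO_bounded8 h1 b1; have b2' := eqO_bounded8 h2 b2.
have e1 := eqO_mul (bounded8X (3 * k + 1) b1') (bounded8_poly _) (eqOX (3 * k + 1) b1' b1 h1) hD.
have e2 := eqOX k b2' b2 h2.
have e0 : eqO n (fun t : R => euler t ^+ (3 * k + 1) * D t)
    (fun t : R => euler (t ^+ 2) ^+ k).
  apply: eqO_eq => t ht; rewrite /D mulrC divfK // expf_neq0 // gt_eqF //.
  by apply: euler_gt0; lra.
have [C hC] := eqO_trans (eqO_sym e1) (eqO_trans e0 e2).
by exists C => t ht; have := hC t ht; rewrite hornerM !horner_exp.
Qed.

Lemma is_d_polyF5 (R : realType) d k n : is_d R d ->
  eqX n (euler_poly 'F_5 n ^+ (3 * k + 1) * \poly_(j < n) (d k j)%:~R)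
    ((euler_poly 'F_5 n \Po 'X^2) ^+ k).
Proof.
move=> hd i ltin.
have /(congr1 (intmul 1 : int -> 'F_5)) := is_d_poly k hd ltin.
rewrite -!(coef_map (intmul 1 : {rmorphism int -> 'F_5})) /=.
rewrite rmorphM !rmorphXn /= map_comp_poly map_polyXn !map_euler_poly => <-.
have -> : map_poly intr (\poly_(j < n) d k j) = \poly_(j < n) (d k j)%:~R :> {poly 'F_5}.
  by apply/polyP => j; rewrite coef_map !coef_poly; case: ifP.
by [].
Qed.

Lemma eqz_mod5P (a : int) : a%:~R = 0 :> 'F_5 -> (a = 0 %[mod 5])%Z.
Proof.
move=> a0; apply/eqP; rewrite eqz_mod_dvd subr0.
by rewrite (dvdz_pcharf (pchar_Fp (isT : prime 5))) a0.
Qed.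

Theorem theorem1p3 (R : realType) (d : nat -> nat -> int) (hd : is_d R d)
    (k n : nat) :
  (d (25 * k + 1)%N (25 * n + 23)%N = 0 %[mod 5])%Z /\
  (d (75 * k + 16)%N (25 * n + 8)%N = 0 %[mod 5])%Z.
Proof.
(* Large enough to see the coefficients below 25(n+1), and 2 modulo 5 for Jacobi's formula. *)
pose N := (25 * n.+1 + 2)%N.
have N5 : (N %% 5 = 2)%N by rewrite /N; lia.
have leN : (25 * n.+1 <= N)%N by rewrite /N; lia.
split; apply: eqz_mod5P.
  have := coef_23 N5 leN (is_d_polyF5 (25 * k + 1) hd) (ltnSn n).
  rewrite !coef_sect // coef0 coef_poly.
  have -> : (5 * (5 * n + 4) + 3 = 25 * n + 23)%N by lia.
  by rewrite ifT // /N; lia.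
have := coef_8 N5 leN (is_d_polyF5 (75 * k + 16) hd) (ltnSn n).
rewrite !coef_sect // coef0 coef_poly.
have -> : (5 * (5 * n + 1) + 3 = 25 * n + 8)%N by lia.
by rewrite ifT // /N; lia.
Qed.
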